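(* Let $G=(V=[n],E,(p_{uv})_{(u,v)\in E})$ be an influence graph and let $k\in\{2,\dots,n\}$. Let $S_0:=\emptyset$ and for $t=1,\dots,k$ let $S_t:=S_{t-1}\cup\{v_t\}$, where $v_t\in V\setminus S_{t-1}$ maximizes $\sigma(S_{t-1}\cup\{v\})$ over $v\in V\setminus S_{t-1}$ (the non-adaptive greedy algorithm, with $\sigma$ evaluated exactly). Then $$\sigma(S_k)\ \ge\ \frac12\left(1-\left(1-\frac1k\right)^k\right)OPT_A(G,k)\ \ge\ \frac12\left(1-\frac1e\right)OPT_A(G,k).$$
   Context: Independent cascade model: $G$ is a directed graph on $V=[n]$ with an activation probability $p_{uv}\in[0,1]$ on each edge. The live-edge graph $\mathbf L\subseteq E$ is random, containing each edge $(u,v)$ independently with probability $p_{uv}$. For $L\subseteq E$ and $S\subseteq V$, $R_L(S)$ is the set of nodes $v$ such that some $u\in S$ has a directed path (possibly of length $0$) to $v$ using edges of $L$; $\sigma_L(S):=|R_L(S)|$ and $\sigma(S):=\mathbb{E}_{\mathbf L}[\sigma_{\mathbf L}(S)]$. Myopic feedback: for $L\subseteq E$ the realisation $\phi_L:V\to2^V$ is $\phi_L(v)=\{v\}\cup\{z:(v,z)\in L\}$; the random realisation is $\Phi:=\phi_{\mathbf L}$. A partial realisation $\psi$ is the restriction of some $\phi_L$ to a set $dom(\psi)\subseteq V$. An adaptive policy $\pi$ maps partial realisations to a node of $V$ or to STOP; it is run by starting from $\psi=\emptyset$ and, while $\pi(\psi)=v\neq$ STOP, setting $\psi\leftarrow\psi\cup\{(v,\Phi(v))\}$;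 the final partial realisation is $\Psi_\pi$. Its expected influence spread is $\sigma(\pi):=\mathbb{E}_{\mathbf L}[\sigma_{\mathbf L}(dom(\Psi_\pi))]$, and $|\pi|=k$ means $|dom(\Psi_\pi)|=k$ always. $OPT_A(G,k)$ is the maximum of $\sigma(\pi)$ over adaptive policies with $|\pi|=k$. *)

(* Defs.v *)
From HB Require Import structures.
From mathcomp Require Import all_boot all_order all_algebra.
From mathcomp Require Import all_classical all_reals all_analysis.
Set Implicit Arguments. Unset Strict Implicit. Unset Printing Implicit Defensive.
Import Order.TTheory GRing.Theory Num.Theory.
Local Open Scope ring_scope.

Notation edge n := ('I_n * 'I_n)%type.

Definition live_prob (R : realType) (n : nat) (E : {set edge n})
    (p : 'I_n -> 'I_n -> R) (L : {set edge n}) : R :=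
  if L \subset E then
    \prod_(e in E) (if e \in L then p e.1 e.2 else 1 - p e.1 e.2)
  else 0.

Definition expect (R : realType) (n : nat) (E : {set edge n})
    (p : 'I_n -> 'I_n -> R) (f : {set edge n} -> R) : R :=
  \sum_(L : {set edge n}) live_prob E p L * f L.

Definition reach (n : nat) (L : {set edge n}) (S : {set 'I_n}) : {set 'I_n} :=
  [set v | [exists u in S, connect (fun x y => (x, y) \in L) u v]].

Definition sigmaL (n : nat) (L : {set edge n}) (S : {set 'I_n}) : nat :=
  #|reach L S|.

Definition sigma (R : realType) (n : nat) (E : {set edge n})
    (p : 'I_n -> 'I_n -> R) (S : {set 'I_n}) : R :=
  expect E p (fun L => (sigmaL L S)%:R).

(* Myopic feedback realisation phi_L(v) = {v} u {z | (v,z) in L}. *)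
Definition realisation (n : nat) (L : {set edge n}) (v : 'I_n) : {set 'I_n} :=
  v |: [set z | (v, z) \in L].

Notation partial n := {ffun 'I_n -> option {set 'I_n}}.
Definition dom (n : nat) (psi : partial n) : {set 'I_n} :=
  [set v | psi v != None].

(* Adaptive policy: partial realisation -> node (Some v) or STOP (None). *)
Notation policy n := {ffun partial n -> option 'I_n}.

Definition step (n : nat) (pi : policy n) (phi : 'I_n -> {set 'I_n})
    (psi : partial n) : partial n :=
  match pi psi with
  | None => psi
  | Some v => [ffun x => if x == v then Some (phi v) else psi x]
  end.

Definition run (n : nat) (pi : policy n) (phi : 'I_n -> {set 'I_n}) (j : nat)
  : partial n := iter j (step pi phi) [ffun _ => None].

(* Final partial realisation: a terminating run stops after at most n steps
   (each non-stopping step must add a new node), after which it is fixed. *)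
Definition final (n : nat) (pi : policy n) (phi : 'I_n -> {set 'I_n})
  : partial n := run pi phi n.

Definition policy_size (n : nat) (E : {set edge n}) (pi : policy n) (k : nat)
  : Prop :=
  forall L : {set edge n}, L \subset E ->
    (exists j, pi (run pi (realisation L) j) = None) /\
    #|dom (final pi (realisation L))| = k.

Definition sigma_pol (R : realType) (n : nat) (E : {set edge n})
    (p : 'I_n -> 'I_n -> R) (pi : policy n) : R :=
  expect E p (fun L => (sigmaL L (dom (final pi (realisation L))))%:R).

(* OPT_A(G,k): maximum of sigma(pi) over the (finitely many) policies with
   |pi| = k (sigma(pi) >= 0, so 0 is a neutral start). *)
Definition OPT_A (R : realType) (n : nat) (E : {set edge n})
    (p : 'I_n -> 'I_n -> R) (k : nat) : R :=
  \big[Num.max/0]_(pi : policy n | `[< policy_size E pi k >]) sigma_pol E p pi.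

(* Main.v *)
(** For any seed set [S], [sigma pi <= 2 sigma S + 2 k max_v (sigma (v |: S) - sigma S)];
   with [S := S_t] this is the recurrence
   [OPT/2 - sigma S_{t+1} <= (1 - 1/k) (OPT/2 - sigma S_t)].
   The inequality is proved separately for each target node [z].  Let [D] be the set of
   nodes whose out-edges the policy has observed, and let [M] be a fresh live-edge graph.
   Let [b] say that [z] is reached from [S :|: D] when the out-edges of [D] are the observed
   ones and all others come from [M], and let [y] be the conditional probability, given the
   out-edges in [M] of the other nodes, that [S] reaches [z] when the out-edges of [D] are
   redrawn.  The potential is the mean over [M] of [1 + max 0 (2 y - 1) ^ 2] if [b] holds and
   of [2 y ^ 2] otherwise.  It starts at [2 P(S reaches z)], always dominates
   [P(D reaches z)], and observing [v] increases its mean by at most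
   [2 P(v reaches z but S does not)]. *)
Require Import Defs.
From HB Require Import structures.
From mathcomp Require Import all_boot all_order all_algebra.
From mathcomp Require Import all_classical all_reals all_analysis.
From mathcomp Require Import ring lra.
Import Order.TTheory GRing.Theory Num.Theory.
Local Open Scope ring_scope.

Set Implicit Arguments.
Unset Strict Implicit.

(** * Splicing live-edge graphs, and reachability in them *)

Section Reach.
Variable n : nat.
Implicit Types (L M N : {set edge n}) (A B D S T : {set 'I_n}) (v z : 'I_n).

(** Edges are sorted by source, since querying a node reveals exactly its out-edges (its row). *)
Definition hyb D L M : {set edge n} :=
  [set e | if e.1 \in D then e \in L else e \in M].

Lemma hyb_cat D L M N : hyb D (hyb D L M) N = hyb D L N.
Proof. by apply/setP => e; rewrite !inE; case: (e.1 \in D). Qed.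

Lemma hybK D L M : hyb D (hyb D L M) (hyb D M L) = L.
Proof. by apply/setP => e; rewrite !inE; case: (e.1 \in D). Qed.

Lemma hyb0 L M : hyb finset.set0 L M = M.
Proof. by apply/setP => e; rewrite !inE. Qed.

Lemma hybU1 v D L N M :
  hyb (v |: D) (hyb D L N) M = hyb D L (hyb [set v] N M).
Proof.
by apply/setP => e; rewrite !inE; case: (e.1 \in D); rewrite ?orbT ?orbF.
Qed.

Lemma hybU1C v D L N M : v \notin D ->
  hyb (v |: D) (hyb [set v] N L) M = hyb D L (hyb [set v] N M).
Proof.
move=> vD; apply/setP => e; rewrite !inE; case: eqP => [->|_] //=.
by rewrite (negbTE vD).
Qed.

Lemma reachP L A z :
  reflect (exists2 u, u \in A & connect (fun x y => (x, y) \in L) u z)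
          (z \in reach L A).
Proof.
rewrite inE; apply: (iffP existsP) => [[u /andP[uA uz]]|[u uA uz]].
  by exists u.
by exists u; rewrite uA.
Qed.

Lemma connect_sub_edges L M x y : L \subset M ->
  connect (fun x y => (x, y) \in L) x y -> connect (fun x y => (x, y) \in M) x y.
Proof.
move=> LM; apply: connect_sub => a b ab; apply: connect1.
exact: (fintype.subsetP LM).
Qed.

Lemma reach_sub L M A B : L \subset M -> A \subset B -> reach L A \subset reach M B.
Proof.
move=> LM AB; apply/fintype.subsetP => z /reachP[u uA uz]; apply/reachP.
by exists u; [exact: (fintype.subsetP AB)|exact: connect_sub_edges uz].
Qed.

Lemma reachU L A B : reach L (A :|: B) = reach L A :|: reach L B.
Proof.
apply/setP => z; rewrite finset.in_setU; apply/reachP/orP.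
  by move=> [u /finset.setUP[uA|uB] uz]; [left|right]; apply/reachP; exists u.
by move=> [] /reachP[u uA uz]; exists u; rewrite // finset.in_setU uA ?orbT.
Qed.

Lemma reach0 L : reach L finset.set0 = finset.set0.
Proof. by apply/setP => z; rewrite finset.in_set0; apply/reachP => -[u]; rewrite finset.in_set0. Qed.

(* Cut the path at its last vertex in T. *)
Lemma connect_last L T x z : connect (fun x y => (x, y) \in L) x z ->
  connect (fun x y => (x, y) \in [set e in L | e.1 \notin T]) x z \/
  exists2 t, t \in T &
    connect (fun x y => (x, y) \in [set e in L | e.1 \notin T :\ t]) t z.
Proof.
move=> /connectP[p + ->]; elim: p x => [|y p IHp] x /=.
  by left; exact: connect0.
move=> /andP[xy /IHp[yz|]]; last by right.
have [xT|xT] := boolP (x \in T); last first.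
  by left; apply: connect_trans yz; apply: connect1; rewrite inE xy.
right; exists x => //; apply: (@connect_trans _ _ y).
  by apply: connect1; rewrite !inE xy eqxx.
apply: connect_sub_edges yz; apply/fintype.subsetP => e; rewrite !inE.
by move=> /andP[-> /negbTE ->]; rewrite andbF.
Qed.

(** Cut the path at its last vertex in [v |: D]: what follows either avoids the row of [v], or
    starts at [v] and avoids the rows of [D]. So the first disjunct is independent of [N], the
    second of [L]. *)
Lemma reach_split z v S D L N M : v \notin D ->
  (z \in reach (hyb D L (hyb [set v] N M)) (S :|: (v |: D))) =
  (z \in reach (hyb D L (hyb [set v] finset.set0 M)) (S :|: D)) ||
  (z \in reach (hyb D finset.set0 (hyb [set v] N M)) [set v]).
Proof.
move=> vD; apply/idP/orP; last first.
  case; apply: (fintype.subsetP (reach_sub _ _)).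
  - apply/fintype.subsetP => e; rewrite !inE.
    by case: (e.1 \in D) => //; case: (e.1 == v).
  - by rewrite finset.setUS// finset.subsetUr.
  - apply/fintype.subsetP => e; rewrite !inE.
    by case: (e.1 \in D) => //; case: (e.1 == v).
  - by rewrite finset.sub1set !inE eqxx orbT.
have subv T : v \in T -> [set e in hyb D L (hyb [set v] N M) | e.1 \notin T]
    \subset hyb D L (hyb [set v] finset.set0 M).
  move=> vT; apply/fintype.subsetP => e; rewrite !inE => /andP[+ eT].
  by case: eqP eT => // ->; rewrite vT.
have subD T : D \subset T -> [set e in hyb D L (hyb [set v] N M) | e.1 \notin T]
    \subset hyb D finset.set0 (hyb [set v] N M).
  move=> /fintype.subsetP DT; apply/fintype.subsetP => e; rewrite !inE => /andP[+ eT].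
  by case: ifPn => // /DT; rewrite (negbTE eT).
move=> /reachP[u uA /(connect_last (v |: D))[uz|[t tT tz]]].
- have [uv|uv] := eqVneq u v.
    right; apply/reachP; exists v; first by rewrite inE.
    by move: uz; rewrite uv; apply: connect_sub_edges; apply: subD; exact: finset.subsetUr.
  left; apply/reachP; exists u; first by move: uA; rewrite !inE (negbTE uv).
  by apply: connect_sub_edges uz; apply: subv; rewrite !inE eqxx.
- have [tv|tv] := eqVneq t v.
    right; apply/reachP; exists v; first by rewrite inE.
    move: tz; rewrite tv; apply: connect_sub_edges; apply: subD.
    apply/fintype.subsetP => d dD; rewrite !inE dD orbT andbT.
    by apply: contraNneq vD => <-.
  left; apply/reachP; exists t; first by move: tT; rewrite !inE (negbTE tv) /= => ->; rewrite orbT.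
  by apply: connect_sub_edges tz; apply: subv; rewrite !inE eqxx eq_sym tv.
Qed.

(** * Runs of a policy *)

Lemma dom_run_sub (pi : policy n) phi j : dom (run pi phi j) \subset dom (run pi phi j.+1).
Proof.
apply/fintype.subsetP => x; rewrite /run iterS -/(run pi phi j) !inE /step.
by case: (pi _) => // v; rewrite ffunE; case: (x == v).
Qed.

(** A run consults [phi] only at the nodes it queries, so both runs see the same partial realisation
    at each step. *)
Lemma run_local (pi : policy n) phi phi' j :
  {in dom (run pi phi j), phi =1 phi'} -> run pi phi' j = run pi phi j.
Proof.
elim: j => // j IHj eqphi.
have /IHj runE : {in dom (run pi phi j), phi =1 phi'}.
  by move=> x /(fintype.subsetP (dom_run_sub pi phi j)); exact: eqphi.
rewrite /run !iterS -!/(run _ _ _) runE /step.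
case piE: (pi _) => [v|//]; rewrite eqphi// inE /run iterS -/(run _ _ _) /step piE.
by rewrite ffunE eqxx.
Qed.

Definition explored (pi : policy n) j L := dom (run pi (realisation L) j).

Lemma run_hyb (pi : policy n) j L M :
  run pi (realisation (hyb (explored pi j L) L M)) j = run pi (realisation L) j.
Proof.
apply: run_local => x xD; apply/setP => y.
by rewrite !inE; move: xD; rewrite inE => ->.
Qed.

(** Stopping-time property: the observed rows alone decide which rows are observed, as
    [expect_resample] requires. *)
Lemma explored_hyb (pi : policy n) j L M :
  explored pi j (hyb (explored pi j L) L M) = explored pi j L.
Proof. by rewrite {1}/explored run_hyb. Qed.

Lemma explored_step (pi : policy n) j L :
  explored pi j.+1 L =
  if pi (run pi (realisation L) j) is Some v then v |: explored pi j L
  else explored pi j L.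
Proof.
rewrite /explored /run iterS -/(run _ _ _) /step.
case: (pi _) => // v; apply/setP => x; rewrite !inE ffunE.
by case: (x == v).
Qed.
End Reach.

(** * Expectation and independent resampling *)

Section Expect.
Variables (R : realType) (n : nat) (E : {set edge n}) (p : 'I_n -> 'I_n -> R).
Hypothesis hp : forall u v : 'I_n, (u, v) \in E -> 0 <= p u v <= 1.
Implicit Types (L M N : {set edge n}) (D : {set 'I_n}) (f g : {set edge n} -> R).

Local Notation P := (live_prob E p).
Local Notation "''E' f" := (expect E p f) (at level 10, f at level 9).

(** Non-edges count as edges of probability 0, so the law is a plain product over all pairs and can
    be rearranged factor by factor. *)
Lemma live_probE L : P L = \prod_(e : edge n)
  (if e \in L then if e \in E then p e.1 e.2 else 0
   else if e \in E then 1 - p e.1 e.2 else 1).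
Proof.
rewrite /live_prob; case: ifPn => [LE|/subsetPn[e eL eE]].
  rewrite [LHS]big_mkcond; apply: eq_bigr => e _ /=.
  case: ifPn => // eE.
  by have -> : (e \in L) = false by apply: contraNF eE; exact: (fintype.subsetP LE).
by rewrite (bigD1 e)//= eL (negbTE eE) mul0r.
Qed.

Lemma live_prob_ge0 L : 0 <= P L.
Proof.
rewrite /live_prob; case: ifP => // _; apply: prodr_ge0 => -[u v] /hp /andP[p0 p1].
by case: ifP; rewrite ?subr_ge0.
Qed.

Lemma live_prob_sum1 : \sum_L P L = 1.
Proof.
under eq_bigr do rewrite live_probE.
rewrite -bigA_distr; apply: big1 => e _.
by rewrite /=; case: ifP => _; rewrite ?subrKC ?add0r.
Qed.

Lemma live_prob_hyb D L M : P (hyb D L M) * P (hyb D M L) = P L * P M.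
Proof.
rewrite !live_probE -!big_split; apply: eq_bigr => e _ /=.
by rewrite !inE; case: (e.1 \in D) => //; rewrite mulrC.
Qed.

Lemma expect_cst (a : R) : 'E (fun=> a) = a.
Proof. by rewrite /expect -mulr_suml live_prob_sum1 mul1r. Qed.

Lemma eq_expect f g : (forall L, f L = g L) -> 'E f = 'E g.
Proof. by move=> fg; apply: eq_bigr => L _; rewrite fg. Qed.

Lemma ler_expect_live f g :
  (forall L, L \subset E -> f L <= g L) -> 'E f <= 'E g.
Proof.
move=> fg; apply: ler_sum => L _.
have [LE|LE] := boolP (L \subset E); first by rewrite ler_wpM2l ?live_prob_ge0// fg.
by rewrite /live_prob (negbTE LE) !mul0r.
Qed.

Lemma ler_expect f g : (forall L, f L <= g L) -> 'E f <= 'E g.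
Proof. by move=> fg; apply: ler_expect_live => L _; exact: fg. Qed.

Lemma expectD f g : 'E (fun L => f L + g L) = 'E f + 'E g.
Proof. by rewrite /expect -big_split; apply: eq_bigr => L _; rewrite mulrDr. Qed.

Lemma expectZ (a : R) f : 'E (fun L => a * f L) = a * 'E f.
Proof. by rewrite /expect mulr_sumr; apply: eq_bigr => L _; rewrite mulrCA. Qed.

Lemma expect_sum (I : finType) (F : I -> {set edge n} -> R) :
  'E (fun L => \sum_i F i L) = \sum_i 'E (F i).
Proof.
rewrite /expect exchange_big; apply: eq_bigr => L _; rewrite mulr_sumr//.
Qed.

Lemma exchange_expect (F : {set edge n} -> {set edge n} -> R) :
  'E (fun L => 'E (F L)) = 'E (fun M => 'E (fun L => F L M)).
Proof.
rewrite /expect; under eq_bigr do rewrite mulr_sumr.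
rewrite exchange_big; apply: eq_bigr => M _; rewrite mulr_sumr.
by apply: eq_bigr => L _; rewrite mulrCA.
Qed.

(* Swapping the rows outside [D L] between two independent graphs preserves their joint law,
   as [D L] is determined by the rows of [L] that are kept. *)
Lemma expect_swap (D : {set edge n} -> {set 'I_n})
    (F : {set edge n} -> {set edge n} -> R) :
  (forall L M, D (hyb (D L) L M) = D L) ->
  'E (fun L => 'E (F L)) =
  'E (fun L => 'E (fun M => F (hyb (D L) L M) (hyb (D L) M L))).
Proof.
move=> DE; rewrite /expect; under eq_bigr do rewrite mulr_sumr.
under [RHS]eq_bigr do rewrite mulr_sumr.
rewrite !pair_bigA /=.
pose T (x : {set edge n} * {set edge n}) :=
  (hyb (D x.1) x.1 x.2, hyb (D x.1) x.2 x.1).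
(* By [DE] the swapped pair has the same [D], so a second swap undoes the first. *)
have TK : involutive T by move=> [L M]; rewrite /T /= DE !hybK.
rewrite (reindex_inj (inv_inj TK)); apply: eq_bigr => -[L M] _ /=.
by rewrite !mulrA live_prob_hyb.
Qed.

(** Conditioning on the observed rows: all others may be drawn afresh. *)
Lemma expect_resample (D : {set edge n} -> {set 'I_n}) f :
  (forall L M, D (hyb (D L) L M) = D L) ->
  'E f = 'E (fun L => 'E (fun M => f (hyb (D L) L M))).
Proof.
move=> DE; rewrite -(@expect_swap D (fun L _ => f L) DE).
by apply: eq_expect => L; rewrite expect_cst.
Qed.


(** * The scalar inequality behind the potential *)

Definition phi (b : bool) (y : R) : R :=
  if b then 1 + Num.max 0 (2 * y - 1) ^+ 2 else 2 * y ^+ 2.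

Lemma phi_ge (b : bool) (y : R) : b%:R <= phi b y.
Proof. by case: b => /=; rewrite ?lerDl ?sqr_ge0// mulr_ge0 ?sqr_ge0. Qed.

Lemma phi_bool (b : bool) : phi b b%:R = 2 * b%:R.
Proof.
rewrite /phi; case: b; last by rewrite expr0n /= !mulr0.
by rewrite mulr1 -[2 - 1]/(1 + 1 - 1) addrK max_r// expr1n.
Qed.

(* [y] is the mean of [eta] over the out-edges of the newly observed node, so the term linear
   in [eta - y], whose slope does not depend on these edges, vanishes on average. *)
Lemma phi_step (b b1 s : bool) (y eta d : R) :
  0 <= y <= 1 -> 0 <= eta <= 1 -> 0 <= d ->
  (b1 -> b) -> (b -> b1 || s) -> (s -> 1 - eta <= d) ->
  phi (b1 || s) y + (if b1 then 4 * Num.max 0 (2 * y - 1) else 4 * y) * (eta - y)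
  <= phi b eta + 2 * d.
Proof.
move=> /andP[y0 y1] /andP[e0 e1] d0; rewrite /phi.
set q := Num.max 0 (2 * y - 1); set r := Num.max 0 (2 * eta - 1).
(* For the case where [s] holds and [b1] fails, with [2 * d] bounded below by [2 * (1 - eta)]. *)
have qle : q ^+ 2 + 4 * y * (eta - y) <= 2 * eta ^+ 2 - 2 * eta + 1.
  rewrite /q; case: (leP 0 (2 * y - 1)) => h.
    (* The two sides differ by twice this product. *)
    have : 0 <= (1 - eta) * (2 * y - eta) by apply: mulr_ge0; lra.
    nra.
  have := sqr_ge0 (eta - y - 2^-1); have := sqr_ge0 (y - 2^-1); nra.
(* The true branch of [phi] dominates the false one, so [qle] serves for both values of [b]. *)
have rge : 2 * eta ^+ 2 - 1 <= r ^+ 2.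
  rewrite /r; case: (leP 0 (2 * eta - 1)) => h; last by nra.
  have := sqr_ge0 (eta - 1); nra.
(* Case [b1]: the convex function [max 0 (2 y - 1) ^ 2] lies above its tangent at [y]. *)
have qr : q ^+ 2 + 4 * q * (eta - y) <= r ^+ 2.
  rewrite /q /r; case: (leP 0 (2 * y - 1)) => hy; case: (leP 0 (2 * eta - 1)) => he.
  - have := sqr_ge0 (eta - y); nra.
  - nra.
  - have := sqr_ge0 (2 * eta - 1); nra.
  - by rewrite !expr0n /= mulr0 mul0r addr0.
case: b1 => [/(_ isT) ->|_] /=; first by move=> _ _; lra.
case: s => /= [_ /(_ isT) de|]; first by case: b; lra.
case: b => [/(_ isT)//|_ _]; have := sqr_ge0 (eta - y); nra.
Qed.

Lemma expect_ge0 f : (forall L, 0 <= f L) -> 0 <= 'E f.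
Proof. by move=> f0; rewrite -(expect_cst 0); exact: ler_expect. Qed.

Lemma hyb_resample D f : 'E f = 'E (fun N => 'E (fun M => f (hyb D N M))).
Proof. exact: (@expect_resample (fun=> D)). Qed.

(** * The potential for a fixed target *)

Section Target.
Variables (S : {set 'I_n}) (z : 'I_n).

Definition refreshed_prob D M : R :=
  'E (fun N => (z \in reach (hyb D N M) S)%:R).

Definition potential D L : R :=
  'E (fun M => phi (z \in reach (hyb D L M) (S :|: D)) (refreshed_prob D M)).

Definition gain v : R :=
  'E (fun M => ((z \in reach M [set v]) && (z \notin reach M S))%:R).

Lemma refreshed_prob_itv D M : 0 <= refreshed_prob D M <= 1.
Proof.
rewrite expect_ge0 => [|L]; last exact: ler0n.
by rewrite -(expect_cst 1) ler_expect// => L; rewrite lern1 leq_b1.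
Qed.

(** Martingale property: in the redraw of [v |: D], the row of [v] can be drawn first. *)
Lemma refreshed_probU1 v D M : v \notin D ->
  refreshed_prob (v |: D) M = 'E (fun N => refreshed_prob D (hyb [set v] N M)).
Proof.
move=> vD; rewrite /refreshed_prob (hyb_resample [set v]).
by apply: eq_expect => N; apply: eq_expect => N'; rewrite hybU1C.
Qed.

Lemma gain_resample v D : gain v =
  'E (fun M => 'E (fun N => 'E (fun N' =>
    ((z \in reach (hyb D N' (hyb [set v] N M)) [set v]) &&
     (z \notin reach (hyb D N' (hyb [set v] N M)) S))%:R))).
Proof.
by rewrite /gain (hyb_resample D) exchange_expect (hyb_resample [set v]) exchange_expect.
Qed.

Lemma potential_step v D L : v \notin D ->
  'E (fun N => potential (v |: D) (hyb D L N)) <= potential D L + 2 * gain v.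
Proof.
move=> vD; rewrite exchange_expect.
have -> : potential D L = 'E (fun M => 'E (fun N =>
    phi (z \in reach (hyb D L (hyb [set v] N M)) (S :|: D))
        (refreshed_prob D (hyb [set v] N M)))).
  (* Coupling: the observed row of [v] on the left and the unobserved one on the right are both
     taken from [N]. *)
  by rewrite /potential (hyb_resample [set v]) exchange_expect.
rewrite (gain_resample v D) -expectZ -expectD.
apply: ler_expect => M /=; rewrite -expectZ -expectD.
set y := refreshed_prob (v |: D) M.
pose eta N := refreshed_prob D (hyb [set v] N M).
pose b1 := z \in reach (hyb D L (hyb [set v] finset.set0 M)) (S :|: D).
pose slope := if b1 then 4 * Num.max 0 (2 * y - 1) else 4 * y.
(* The added term has mean zero, as [y] is the mean of [eta] and [slope] does not involve [N]. *)
have -> : 'E (fun N => phi (z \in reach (hyb (v |: D) (hyb D L N) M) (S :|: (v |: D))) y)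
   = 'E (fun N => phi (z \in reach (hyb (v |: D) (hyb D L N) M) (S :|: (v |: D))) y
                  + slope * (eta N + - y)).
  rewrite expectD expectZ expectD expect_cst -refreshed_probU1// subrr mulr0.
  by rewrite addr0.
apply: ler_expect => N /=; rewrite hybU1 reach_split//.
apply: phi_step; rewrite ?refreshed_prob_itv//.
- by apply: expect_ge0 => N'; rewrite ler0n.
- apply: (fintype.subsetP (reach_sub _ _)) => //.
  apply/fintype.subsetP => e; rewrite !inE.
  by case: (e.1 \in D) => //; case: (e.1 == v).
- rewrite -reach_split//; apply: (fintype.subsetP (reach_sub _ _)) => //.
  by rewrite finset.setUS// finset.subsetUr.
(* A path from [v] that avoids the rows of [D] survives every redraw [N'], so the gain is at least
   the probability [1 - eta] that [S] misses [z]. *)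
- move=> vz; rewrite -[X in X - _ <= _](expect_cst 1) -mulN1r -expectZ -expectD.
  apply: ler_expect => N' /=; rewrite mulN1r.
  have -> : z \in reach (hyb D N' (hyb [set v] N M)) [set v].
    apply: (fintype.subsetP (reach_sub _ _)) vz => //.
    by apply/fintype.subsetP => e; rewrite !inE; case: (e.1 \in D).
  by case: (z \in _) => /=; rewrite ?subrr ?subr0.
Qed.

Lemma potential_hyb D L N : potential D (hyb D L N) = potential D L.
Proof. by apply: eq_expect => M; rewrite hyb_cat. Qed.

Lemma potential_run (pi : policy n) j :
  'E (fun L => potential (explored pi j L) L) <=
  2 * 'E (fun L => (z \in reach L S)%:R) +
  2 * 'E (fun L => \sum_(v in explored pi j L) gain v).
Proof.
elim: j => [|j IHj].
  have D0 L : explored pi 0 L = finset.set0 by apply/setP => x; rewrite !inE ffunE.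
  have -> : 'E (fun L => \sum_(v in explored pi 0 L) gain v) = 0.
    by rewrite -[RHS]expect_cst; apply: eq_expect => L; rewrite D0 big_set0.
  rewrite mulr0 addr0 -expectZ.
  suff pot0 L : potential (explored pi 0 L) L =
      'E (fun M => 2 * (z \in reach M S)%:R).
    by under eq_expect do rewrite pot0; rewrite expect_cst.
  (* With nothing observed there is nothing to redraw, so the refreshed probability is the 0/1 value
     of [b] itself. *)
  rewrite D0; apply: eq_expect => M; rewrite hyb0 finset.setU0 -phi_bool.
  congr (phi _ _); rewrite -[RHS]expect_cst.
  by apply: eq_expect => N; rewrite hyb0.
pose W (X : {set 'I_n}) := \sum_(v in X) gain v.
suff step : 'E (fun L => potential (explored pi j.+1 L) L) +
         2 * 'E (fun L => W (explored pi j L)) <=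
       'E (fun L => potential (explored pi j L) L) +
         2 * 'E (fun L => W (explored pi j.+1 L)).
  rewrite -(lerD2r (2 * 'E (fun L => W (explored pi j L)))).
  by apply: le_trans step _; rewrite addrAC lerD2r.
rewrite -!expectZ -!expectD (expect_resample _ (explored_hyb pi j)).
apply: ler_expect => L /=; rewrite expectD explored_step.
set D := explored pi j L.
have -> : 'E (fun M => 2 * W (explored pi j (hyb D L M))) = 2 * W D.
  by rewrite -[RHS]expect_cst; apply: eq_expect => M; rewrite explored_hyb.
have -> : 'E (fun M => potential (explored pi j.+1 (hyb D L M)) (hyb D L M)) =
    'E (fun M => potential (if pi (run pi (realisation L) j) is Some v
                            then v |: D else D) (hyb D L M)).
  by apply: eq_expect => M; rewrite explored_step run_hyb explored_hyb.
have same : 'E (fun M => potential D (hyb D L M)) = potential D L.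
  by rewrite -[RHS]expect_cst; apply: eq_expect => M; rewrite potential_hyb.
case: (pi _) => [v|]; last by rewrite same.
(* A policy may query a node again; this changes nothing. *)
have [vD|vD] := boolP (v \in D).
  by rewrite (_ : v |: D = D) ?same//; apply/finset.setUidPr; rewrite finset.sub1set.
by rewrite /W finset.big_setU1//= mulrDr addrA lerD2r potential_step.
Qed.

Lemma reach_explored (pi : policy n) j :
  'E (fun L => (z \in reach L (explored pi j L))%:R) <=
  2 * 'E (fun L => (z \in reach L S)%:R) +
  2 * 'E (fun L => \sum_(v in explored pi j L) gain v).
Proof.
apply: le_trans (potential_run pi j).
rewrite (expect_resample _ (explored_hyb pi j)).
apply: ler_expect => L; apply: ler_expect => M.
apply: le_trans (phi_ge _ _); rewrite explored_hyb ler_nat.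
case: (boolP (_ \in reach _ (explored pi j L))) => // zD; apply: eq_leq.
apply/esym/eqP; rewrite eqb1.
by apply: (fintype.subsetP (reach_sub _ _)) zD => //; apply: finset.subsetUr.
Qed.
End Target.

(** * Summation over targets *)

Local Notation sg := (sigma E p).

Lemma expect_card (F : {set edge n} -> {set 'I_n}) :
  'E (fun L => #|F L|%:R) = \sum_z 'E (fun L => (z \in F L)%:R).
Proof.
rewrite -expect_sum; apply: eq_expect => L.
by rewrite -sum1_card natr_sum big_mkcond; apply: eq_bigr => z _; case: (z \in _).
Qed.

Lemma sum_gain (S : {set 'I_n}) v : \sum_z gain S z v = sg (v |: S) - sg S.
Proof.
apply/eqP; rewrite eq_sym subr_eq; apply/eqP.
rewrite /sigma /sigmaL !expect_card -big_split; apply: eq_bigr => z _ /=.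
rewrite -expectD; apply: eq_expect => L; rewrite reachU finset.in_setU.
by case: (z \in _) => /=; case: (z \in _); rewrite ?addr0 ?add0r.
Qed.

Lemma sigma_subset (S T : {set 'I_n}) : S \subset T -> sg S <= sg T.
Proof.
by move=> ST; apply: ler_expect => L; rewrite ler_nat subset_leq_card// reach_sub.
Qed.

Lemma sigma0 : sg finset.set0 = 0.
Proof.
by rewrite -[RHS]expect_cst; apply: eq_expect => L; rewrite /sigmaL reach0 finset.cards0.
Qed.

Lemma sigma_pol_le (pi : policy n) (S : {set 'I_n}) k (d : R) :
  policy_size E pi k -> (forall v, sg (v |: S) - sg S <= d) ->
  sigma_pol E p pi <= 2 * sg S + 2 * (k%:R * d).
Proof.
move=> pik Sd; rewrite /sigma_pol /sigmaL expect_card.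
apply: le_trans (ler_sum _ (fun z _ => reach_explored S z pi n)) _.
rewrite big_split /= -!mulr_sumr -expect_card lerD2l ler_pM2l// -expect_sum.
(* [policy_size] constrains only graphs inside [E], which carry all the mass. *)
rewrite -[leRHS]expect_cst; apply: ler_expect_live => L /pik[_ <-].
rewrite exchange_big /= mulr_natl -sumr_const.
by apply: ler_sum => v _; rewrite sum_gain.
Qed.

Lemma sigma_pol_ge0 (pi : policy n) : 0 <= sigma_pol E p pi.
Proof. by apply: expect_ge0 => L; rewrite ler0n. Qed.

Lemma OPT_A_ge0 k : 0 <= OPT_A E p k.
Proof. by rewrite /OPT_A; elim/big_ind: _ => // [x y x0 y0|pi _]; rewrite ?le_max ?x0 ?sigma_pol_ge0. Qed.

Lemma OPT_A_le k (x : R) : 0 <= x ->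
  (forall pi, policy_size E pi k -> sigma_pol E p pi <= x) -> OPT_A E p k <= x.
Proof.
move=> x0 polx; rewrite /OPT_A; elim/big_ind: _ => //.
  by move=> a b ax bx; rewrite ge_max ax.
by move=> pi /asboolP; exact: polx.
Qed.

End Expect.

(** The [k]-th power of [1 + x <= expR x] at [x = - 1 / k]. *)
Lemma expr_subinv_le_expR (R : realType) k : (0 < k)%N ->
  (1 - k%:R^-1) ^+ k <= expR (-1) :> R.
Proof.
move=> k0; have -> : expR (-1) = expR (- k%:R^-1) ^+ k :> R.
  by rewrite -expRM_natl mulrN mulfV ?pnatr_eq0 -?lt0n.
apply: lerXn2r; rewrite ?nnegrE ?expR_ge0 ?expR_ge1Dx//.
by rewrite subr_ge0 invf_le1 ?ltr0n// ler1n.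
Qed.

(** * The greedy recurrence *)

Theorem theorem5 (R : realType) (n : nat) (E : {set ('I_n * 'I_n)})
  (p : 'I_n -> 'I_n -> R)
  (hp : forall u v : 'I_n, (u, v) \in E -> 0 <= p u v <= 1)
  (k : nat) (hk2 : (2 <= k)%N) (hkn : (k <= n)%N)
  (S : nat -> {set 'I_n}) (hS0 : S 0%N = finset.set0)
  (hS : forall t : nat, (t < k)%N ->
     exists2 v : 'I_n, v \notin S t &
       S t.+1 = v |: S t /\
       (forall w : 'I_n, w \notin S t ->
          sigma E p (w |: S t) <= sigma E p (v |: S t))) :
  2^-1 * (1 - (1 - k%:R^-1) ^+ k) * OPT_A E p k <= sigma E p (S k) /\
  2^-1 * (1 - expR (-1)) * OPT_A E p k
    <= 2^-1 * (1 - (1 - k%:R^-1) ^+ k) * OPT_A E p k.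
Proof.
have k0 : (0 < k)%N by exact: ltnW.
have OPT0 : 0 <= OPT_A E p k by exact: OPT_A_ge0.
split; last first.
  rewrite ler_wpM2r// ler_pM2l ?invr_gt0// lerD2l lerN2.
  exact: expr_subinv_le_expR.
have kR : k%:R != 0 :> R by rewrite pnatr_eq0 -lt0n.
set O := OPT_A E p k in OPT0 *; set a := 1 - k%:R^-1.
have a0 : 0 <= a by rewrite /a subr_ge0 invf_le1 ?ltr0n// ler1n.
have step t : (t < k)%N ->
    2^-1 * O - sigma E p (S t.+1) <= a * (2^-1 * O - sigma E p (S t)).
  move=> tk; have [v vS [St1 vmax]] := hS t tk.
  have mono : sigma E p (S t) <= sigma E p (S t.+1).
    by rewrite St1 sigma_subset// finset.subsetUr.
  have OPTle : O <= 2 * sigma E p (S t) +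
      2 * (k%:R * (sigma E p (S t.+1) - sigma E p (S t))).
    have sig0 : 0 <= sigma E p (S t) by apply: expect_ge0 => // L; rewrite ler0n.
    apply: OPT_A_le => [|pi pik].
      by rewrite addr_ge0// mulr_ge0// mulr_ge0// subr_ge0.
    apply: sigma_pol_le => // w; rewrite lerD2r.
    (* Greedy compares only nodes outside [S t]; a node inside has zero marginal gain, covered by
       [mono]. *)
    have [wS|/vmax] := boolP (w \in S t); last by rewrite St1.
    by rewrite (_ : w |: S t = S t)//; apply/finset.setUidPr; rewrite finset.sub1set.
  (* Dividing [OPTle] by [2 k] gives the contraction factor [a]. *)
  have kinv : 0 <= k%:R^-1 :> R by rewrite invr_ge0.
  have := ler_wpM2l kinv OPTle.
  rewrite mulrDr [X in _ + X](_ : _ = 2 * (sigma E p (S t.+1) - sigma E p (S t))).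
    rewrite /a; lra.
  by rewrite mulrCA mulKf.
have main t : (t <= k)%N -> 2^-1 * O - sigma E p (S t) <= a ^+ t * (2^-1 * O).
  elim: t => [_|t IHt tk]; first by rewrite hS0 sigma0 // subr0 expr0 mul1r.
  apply: le_trans (step t tk) _; rewrite exprS -mulrA ler_wpM2l//.
  exact/IHt/ltnW.
have := main k (leqnn k); lra.
Qed.
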